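(* For all integers $d,m\ge1$ there exists a constant $c_{m,d}>0$ such that for all $B>0$ and $n\in\mathbb N_{\ge1}$ with $Bn^{-m/d}\ge c_{m,d}(1+\log n)$: \[e^{\mathrm{ad\text{-}stoch}}_n(\mathcal F_{d,m,B},S_{\mathrm{samp}},D_{\sup\text{-}\log})\ge\Omega_{m,d}(Bn^{-m/d}),\quad e^{\mathrm{ad\text{-}stoch}}_n(\mathcal F_{d,m,B},S_{\mathrm{samp}},D_{\mathrm{TV}})\ge\Omega_{m,d}(1),\quad e^{\mathrm{ad\text{-}stoch}}_n(\mathcal F_{d,m,B},S_{\mathrm{samp}},W_1)\ge\Omega_{m,d}(1).\]
   Context: Let $\mathcal X=[0,1]^d$ with Lebesgue measure. For bounded measurable $f:\mathcal X\to\mathbb R$ let $Z_f=\int_{\mathcal X}e^{f}dx$ and $P_f$ the distribution with density $e^f/Z_f$; $S_{\mathrm{samp}}(f)=P_f$. For $f\in C^m(\mathcal X)$, $\|f\|_{C^m}=\sup_{|\alpha|_1\le m}\|\partial^\alpha f\|_\infty$, $\mathcal F_{d,m,B}=\{f\in C^m(\mathcal X):\|f\|_{C^m}\le B\}$. Distances: $D_{\sup\text{-}\log}(P,Q)=\|\log(dP/dQ)\|_\infty$ ($=\infty$ unless mutually absolutely continuous); $D_{\mathrm{TV}}(P,Q)=\sup_A|P(A)-Q(A)|$; $W_1(P,Q)=\inf_{X\sim P,Y\sim Q}\mathbb E\|X-Y\|_2$. Stochastic sampling algorithms: given a probability space $(\Omega,P_\Omega)$, a random sample has the form $X_f(\omega)=\tilde\phi(N(f,\omega),\omega)\in\mathcal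 X$, where $N(f,\omega)=(f(x_1),\dots,f(x_n))$ with each $x_k$ allowed to depend on $\omega$ and $f(x_1),\dots,f(x_{k-1})$; $\tilde S(f)$ is the distribution of $X_f(\omega)$, $\omega\sim P_\Omega$. $\mathcal A^{\mathrm{ad\text{-}stoch}}_n$ is the set of all such $\tilde S$, and $e^{\mathrm{ad\text{-}stoch}}_n(\mathcal F,S_{\mathrm{samp}},D)=\inf_{\tilde S}\sup_{f\in\mathcal F}D(P_f,\tilde S(f))$. Notation: $g\ge\Omega_{m,d}(h)$ means there is $c'_{m,d}>0$ depending only on $m,d$ with $g\ge c'_{m,d}h$ for all admissible $B,n$. *)

(* Defs.v *)
From HB Require Import structures.
From mathcomp Require Import all_boot all_order all_algebra.
From mathcomp Require Import all_classical all_reals all_analysis.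
Set Implicit Arguments. Unset Strict Implicit. Unset Printing Implicit Defensive.
Import Order.TTheory GRing.Theory Num.Theory.
Import numFieldNormedType.Exports.
Local Open Scope classical_set_scope.
Local Open Scope ring_scope.

Section Defs.
Variable R : realType.

(* d.-tuple R carries the product (Borel) sigma-algebra of the library.       *)
Definition cube (d : nat) : set (d.-tuple R) :=
  [set x | forall i : 'I_d, 0 <= tnth x i <= 1].

Definition clamp (d : nat) (x : d.-tuple R) : d.-tuple R :=
  [tuple Num.min 1 (Num.max 0 (tnth x i)) | i < d].

Definition eucl_dist (d : nat) (x y : d.-tuple R) : R :=
  Num.sqrt (\sum_(i < d) (tnth x i - tnth y i) ^+ 2).

(* ---------- Lebesgue integral over [0,1]^d (iterated, Fubini-Tonelli) ---------- *)
Fixpoint cube_integral (d : nat) : (d.-tuple R -> \bar R) -> \bar R :=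
  match d return (d.-tuple R -> \bar R) -> \bar R with
  | 0 => fun g => g [tuple]
  | d'.+1 => fun g =>
      (\int[@lebesgue_measure R]_(t in `[0%R, 1%R]) cube_integral
          (fun x : d'.-tuple R => g [tuple of t :: x]))%E
  end.

Definition Zf (d : nat) (f : d.-tuple R -> R) : \bar R :=
  cube_integral (fun x => (expR (f x))%:E).

Definition Pf (d : nat) (f : d.-tuple R -> R) : set (d.-tuple R) -> \bar R :=
  fun A => (cube_integral (fun x => (\1_A x * expR (f x))%:E)
            * ((fine (Zf f))^-1)%:E)%E.

Definition rv2t (d : nat) (v : 'rV[R]_d) : d.-tuple R := [tuple v ord0 i | i < d].

Definition unit_vec (d : nat) (i : 'I_d) : 'rV[R]_d := delta_mx ord0 i.

Fixpoint pderiv (d : nat) (l : seq 'I_d) (g : 'rV[R]_d -> R) : 'rV[R]_d -> R :=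
  match l with
  | [::] => g
  | i :: l' => fun x => derive (pderiv l' g) x (unit_vec i)
  end.

Definition Cm (d m : nat) (g : 'rV[R]_d -> R) : Prop :=
  forall l : seq 'I_d, (size l <= m)%N ->
    continuous (pderiv l g) /\
    ((size l < m)%N -> forall (i : 'I_d) (x : 'rV[R]_d), derivable (pderiv l g) x (unit_vec i)).

(* F_{d,m,B}: f in C^m([0,1]^d) (i.e. restriction to the cube of a C^m function on R^d)
   with sup_{|alpha| <= m} sup_{x in [0,1]^d} |d^alpha f (x)| <= B.
   Only the values of f on [0,1]^d are ever used below. *)
Definition Fclass (d m : nat) (B : R) : set (d.-tuple R -> R) :=
  [set f | Cm m (fun v => f (rv2t v)) /\
     forall l : seq 'I_d, (size l <= m)%N ->
       forall v : 'rV[R]_d, cube (rv2t v) -> `|pderiv l (fun u => f (rv2t u)) v| <= B].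

Definition D_TV (d : nat) (P Q : set (d.-tuple R) -> \bar R) : \bar R :=
  ereal_sup [set (`|P A - Q A|)%E | A in [set A : set (d.-tuple R) | measurable A]].

(* || log dP/dQ ||_inf : essential sup (w.r.t. Q) of |log h| over densities h = dP/dQ;
   +oo if P, Q are not mutually absolutely continuous *)
Definition D_suplog (d : nat) (P Q : set (d.-tuple R) -> \bar R) : \bar R :=
  ereal_inf [set c%:E | c in [set c : R | exists h : d.-tuple R -> R,
     [/\ measurable_fun setT h, (forall x, 0 < h x),
         (forall A, measurable A -> P A = (\int[Q]_(x in A) (h x)%:E)%E) &
         {ae Q, forall x, `|ln (h x)| <= c}]]].

Definition W1 (d : nat) (P Q : set (d.-tuple R) -> \bar R) : \bar R :=
  ereal_inf [set (\int[g]_z (eucl_dist z.1 z.2)%:E)%E |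
    g in [set g : probability (d.-tuple R * d.-tuple R)%type R |
      forall A : set (d.-tuple R), measurable A ->
        g (A `*` setT) = P A /\ g (setT `*` A) = Q A]].

(* query k omega (y_1..y_k) = x_{k+1};  output omega (y_1..y_n) = sample.
   Query points and output are projected into [0,1]^d. *)
Record stoch_alg (d : nat) (Omega : Type) := StochAlg {
  query : nat -> Omega -> seq R -> d.-tuple R ;
  output : Omega -> seq R -> d.-tuple R }.

Fixpoint info (d : nat) (Omega : Type) (A : stoch_alg d Omega)
    (f : d.-tuple R -> R) (w : Omega) (k : nat) : seq R :=
  match k with
  | 0 => [::]
  | k'.+1 => let ys := info A f w k' in
             rcons ys (f (clamp (query A k' w ys)))
  end.

Definition sample (d : nat) (Omega : Type) (A : stoch_alg d Omega) (n : nat)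
    (f : d.-tuple R -> R) (w : Omega) : d.-tuple R :=
  clamp (output A w (info A f w n)).

Definition err_ad_stoch (d n : nat) (F : set (d.-tuple R -> R))
    (D : (set (d.-tuple R) -> \bar R) -> (set (d.-tuple R) -> \bar R) -> \bar R)
    : \bar R :=
  ereal_inf [set e : \bar R | exists (dO : measure_display)
      (Omega : measurableType dO) (POm : probability Omega R)
      (A : stoch_alg d Omega),
    (forall f, F f -> measurable_fun setT (sample A n f)) /\
    e = ereal_sup [set D (Pf f) (pushforward POm (sample A n f)) | f in F]].

End Defs.

(* Main.v *)
(* Fix the half-spaces x_0 > 1/2 and x_0 <= 1/2; the sample produced for f = 0 lies
   in one of them, H, with probability at least 1/2.  Place at least 4n disjoint bumps of
   height of order T = B n^(-m/d) in the corner of the cube at distance 1/6 from H.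
   On each run the n queries meet at most n of the bumps, so for some bump f the
   sample still lies in H with probability at least 1/4.  On the other hand
   Z_f >= e^(gamma T) / (48^d n), which beats n as soon as T >= c (1 + log n), and
   f = 0 on H, so P_f(H) <= 1 / Z_f is exponentially small in T.  This discrepancy on
   H bounds all three distances from below. *)

Require Import Defs.
From HB Require Import structures.
From mathcomp Require Import all_boot all_order all_algebra.
From mathcomp Require Import all_classical all_reals all_analysis.
From mathcomp Require Import measurable_realfun zify ring lra.
Import Order.TTheory GRing.Theory Num.Theory.
Import numFieldNormedType.Exports.
Set Implicit Arguments.
Unset Strict Implicit.
Unset Printing Implicit Defensive.
Local Open Scope classical_set_scope.
Local Open Scope ring_scope.

(** * Iterated integrals over the cube and an upper bound for [Pf] *)

(** The integral of a nonnegative function is a supremum over the simple functions below it, so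
    monotonicity asks for no measurability. Inner integrals and the indicator of an arbitrary set in
    [Pf] can then be bounded directly. *)
Lemma ge0_le_integral_nomeas (R : realType) (dT : measure_display)
    (T : measurableType dT) (mu : {measure set T -> \bar R}) (D : set T)
    (f g : T -> \bar R) :
  (forall x, D x -> (0 <= f x)%E) -> (forall x, D x -> (f x <= g x)%E) ->
  (\int[mu]_(x in D) f x <= \int[mu]_(x in D) g x)%E.
Proof.
move=> f0 fg; rewrite !(integral_mkcond D).
have fD0 x : (0 <= (f \_ D) x)%E by apply: erestrict_ge0.
have fgD x : ((f \_ D) x <= (g \_ D) x)%E by apply: lee_restrict.
rewrite !ge0_integralTE//; last by move=> x; exact: le_trans (fgD x).
apply: ge_ereal_sup => _ [h /= hf <-]; apply: ereal_sup_ubound.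
by exists h => //= x; exact: le_trans (fgD x).
Qed.

Lemma cube_integral_ge0 (R : realType) (d : nat) (g : d.-tuple R -> \bar R) :
  (forall x, (0 <= g x)%E) -> (0 <= cube_integral g)%E.
Proof.
elim: d g => [|d IHd] g g0 /=; first exact: g0.
by apply: integral_ge0 => t _; apply: IHd.
Qed.

Lemma cube_integral_le_cst (R : realType) (d : nat) (g : d.-tuple R -> \bar R)
    (c : R) :
  (forall x, (0 <= g x <= c%:E)%E) -> (cube_integral g <= c%:E)%E.
Proof.
elim: d g => [|d IHd] g gc /=; first by case/andP: (gc [tuple]).
have -> : c%:E = (\int[@lebesgue_measure R]_(t in `[0%R, 1%R]) (cst c%:E t))%E.
  rewrite integral_cst//= lebesgue_measure_itv/= lte01 oppr0.
  by rewrite -EFinD addr0 mule1.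
apply: ge0_le_integral_nomeas => t _.
  by apply: cube_integral_ge0 => x; case/andP: (gc [tuple of t :: x]).
by apply: IHd.
Qed.

(** Induction on [d]: the inner integral dominates a constant times the indicator of the first side
    of the box, and integrating that indicator contributes one more factor [l]. *)
Lemma cube_integral_ge_box (R : realType) (d : nat) (g : d.-tuple R -> \bar R)
    (a : 'I_d -> R) (l c : R) :
  0 <= c -> 0 <= l -> (forall x, (0 <= g x)%E) ->
  (forall i, 0 <= a i /\ a i + l <= 1) ->
  (forall x, (forall i, a i <= tnth x i <= a i + l) -> (c%:E <= g x)%E) ->
  ((c * l ^+ d)%:E <= cube_integral g)%E.
Proof.
move=> c0 l0; elim: d g a => [|d IHd] g a g0 ha gc /=.
  by rewrite expr0 mulr1; apply: gc => -[].
have [a0 al] := ha ord0.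
have cl0 : 0 <= c * l ^+ d by rewrite mulr_ge0// exprn_ge0.
have sub : `[a ord0, a ord0 + l] `<=` `[0%R, 1%R].
  by move=> t /=; rewrite !in_itv/=; lra.
apply: (@le_trans _ _ (\int[@lebesgue_measure R]_(t in `[0%R, 1%R])
    ((c * l ^+ d)%:E * (\1_(`[a ord0, a ord0 + l]%classic) t)%:E)))%E.
  rewrite ge0_integralZl_EFin//; last first.
    by apply/measurable_EFinP; exact: measurable_indic.
  rewrite integral_indic// (setIidl sub)/= lebesgue_measure_itv/= lte_fin.
  case: ltP => h.
    by rewrite -EFinB -EFinM lee_fin exprSr mulrA addrC addKr.
  have -> : l = 0 by lra.
  by rewrite mule0 exprSr mulr0 mulr0.
apply: ge0_le_integral_nomeas => t _.
  by rewrite -EFinM lee_fin mulr_ge0.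
rewrite indicE; case: (boolP (t \in _)) => ht /=; last first.
  by rewrite mule0; apply: cube_integral_ge0.
rewrite mule1; apply: (IHd _ (fun i => a (lift ord0 i))) => // x xa.
apply: gc => i; case: (unliftP ord0 i) => [j ->|->].
  by rewrite tnthS; exact: xa.
by move: ht; rewrite inE/= in_itv/= tnth0.
Qed.

(** On [A] the unnormalised density is at most 1 and the cube has volume 1, so the numerator is at
    most 1. *)
Lemma Pf_le (R : realType) (d : nat) (f : d.-tuple R -> R) (A : set (d.-tuple R))
    (M z : R) :
  (forall x, f x <= M) -> (forall x, A x -> f x <= 0) ->
  0 < z -> (z%:E <= Zf f)%E -> (0 <= Pf f A <= (z^-1)%:E)%E.
Proof.
move=> fM fA z0 zZ.
(* [fine] sends an infinite value to 0; the bound [M] keeps the normalising constant finite. *)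
have Zfin : Zf f \is a fin_num.
  have ZM : (Zf f <= (expR M)%:E)%E.
    apply: cube_integral_le_cst => x.
    by rewrite !lee_fin expR_ge0 ler_expR fM.
  rewrite ge0_fin_numE; first by rewrite (le_lt_trans ZM) ?ltry.
  by apply: le_trans zZ; rewrite lee_fin ltW.
have zfZ : z <= fine (Zf f) by rewrite -lee_fin fineK.
have fZ0 : 0 < fine (Zf f) by apply: lt_le_trans zfZ.
have num x : 0 <= (\1_A x : R) * expR (f x) <= 1.
  rewrite indicE; case: (asboolP (A x)) => Ax.
    rewrite mem_set// mul1r expR_ge0/= -expR0 ler_expR; exact: fA.
  by rewrite memNset// mul0r lexx ler01.
have I0 : (0 <= cube_integral (fun x => (\1_A x * expR (f x))%:E))%E.
  by apply: cube_integral_ge0 => x; rewrite lee_fin; case/andP: (num x).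
have I1 : (cube_integral (fun x => (\1_A x * expR (f x))%:E) <= 1%:E)%E.
  by apply: cube_integral_le_cst => x; rewrite !lee_fin; exact: num.
apply/andP; split.
  by rewrite mule_ge0// lee_fin invr_ge0 ltW.
apply: (@le_trans _ _ (1 * ((fine (Zf f))^-1)%:E)%E).
  by apply: lee_wpmul2r => //; rewrite lee_fin invr_ge0 ltW.
by rewrite mul1e lee_fin lef_pV2.
Qed.

(** * What [n] adaptive queries can detect *)

(** Agreement is assumed only at the points queried on [g]: as long as the answers coincide, an
    adaptive rule queries the same points for [f]. *)
Lemma info_eq (R : realType) (d : nat) (Omega : Type) (A : stoch_alg R d Omega)
    (f g : d.-tuple R -> R) (w : Omega) (n : nat) :
  (forall k, (k < n)%N ->
     f (clamp (query A k w (info A g w k))) = g (clamp (query A k w (info A g w k)))) ->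
  info A f w n = info A g w n.
Proof.
elim: n => [|n IHn] // fg /=.
by rewrite IHn ?fg// => k kn; apply: fg; exact: ltnW.
Qed.

(* A run on [0] queries only [n] points, and each of them sees at most one of the
   bumps; every other bump leaves the sample unchanged. *)
Lemma card_sample_neq (R : realType) (d : nat) (Omega : Type)
    (A : stoch_alg R d Omega) (I : finType) (f : I -> d.-tuple R -> R) (w : Omega)
    (n : nat) (S : {pred I}) :
  (forall x i j, f i x != 0 -> f j x != 0 -> i = j) ->
  (forall i, i \in S -> sample A n (f i) w != sample A n (fun=> 0) w) ->
  (#|S| <= n)%N.
Proof.
move=> fdisj fS.
pose q (k : nat) := clamp (query A k w (info A (fun=> 0) w k)).
have hit i : i \in S -> exists k : 'I_n, f i (q k) != 0.
  move=> /fS; apply: contra_neqP => /forallNP h.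
  rewrite /sample (@info_eq _ _ _ _ (f i) (fun=> 0))// => k kn.
  by have /negP := h (Ordinal kn); rewrite negbK => /eqP.
pose h (i : I) := [pick k : 'I_n | f i (q k) != 0].
have hP i : i \in S -> exists2 k, h i = Some k & f i (q k) != 0.
  move=> /hit[k fk]; rewrite /h; case: pickP => [k' fk'|/(_ k)]; first by exists k'.
  by rewrite fk.
have hinj : {in S &, injective h}.
  move=> i j /hP[k -> fi] /hP[k' -> fj] [kk'].
  by apply: (fdisj (q k)) => //; rewrite kk'.
rewrite -(card_in_imset hinj) -[leqRHS]card_ord.
rewrite -(@card_imset _ _ Some 'I_n (@Some_inj _)).
apply: subset_leq_card; apply/fintype.subsetP => _ /imsetP[i /hP[k -> _] ->].
exact: imset_f.
Qed.

(** The expected number of events [N i] that occur is at most [n], so their average probability is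
    at most n / |I| <= e. *)
Lemma exists_measure_le_mean (R : realType) (dO : measure_display)
    (Omega : measurableType dO) (P : probability Omega R) (I : finType)
    (N : I -> set Omega) (n : nat) (e : R) :
  (forall i, measurable (N i)) ->
  (forall w, #|[pred i | w \in N i]| <= n)%N ->
  (0 < #|I|)%N -> n%:R <= e * #|I|%:R ->
  exists i, (P (N i) <= e%:E)%E.
Proof.
move=> mN card_le I0 ne.
have sum_le : (\sum_(i : I) P (N i) <= n%:R%:E)%E.
  have -> : (\sum_(i : I) P (N i) = \int[P]_w \sum_(i : I) (\1_(N i) w)%:E)%E.
    rewrite ge0_integral_sum//.
      by apply: eq_bigr => i _; rewrite integral_indic// setIT.
    by move=> i; apply/measurable_EFinP; exact: measurable_indic.
  have -> : (n%:R%:E = \int[P]_w (cst n%:R%:E w))%E.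
    by rewrite integral_cst//= probability_setT mule1.
  apply: ge0_le_integral_nomeas => w _; first exact: sume_ge0.
  rewrite sumEFin lee_fin/=.
  rewrite (eq_bigr (fun i : I => (w \in N i)%:R)) => [|i _]; last by rewrite indicE.
  rewrite -natr_sum ler_nat -big_mkcond/= sum1_card.
  exact: card_le.
apply: contrapT => /forallNP h.
have {}h i : (e%:E < P (N i))%E by rewrite ltNge; apply/negP.
have : (\sum_(i : I) e%:E < \sum_(i : I) P (N i))%E.
  rewrite -(eq_bigr _ (fun i _ => fineK (fin_num_measure P _ (mN i)))).
  rewrite !sumEFin lte_fin; apply: ltr_sum => [|i _].
    by case/card_gt0P: I0 => i _; apply/hasP; exists i => //; rewrite mem_index_enum.
  by rewrite -lte_fin fineK ?fin_num_measure//; exact: h.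
move=> /lt_le_trans /(_ sum_le); rewrite sumEFin lte_fin sumr_const -[e *+ _]mulr_natr.
by move=> /lt_le_trans /(_ ne); rewrite ltxx.
Qed.

(** * A compactly supported bump on the line *)

Definition pospow (R : realType) (k : nat) (s : R) : R := Num.max 0 s ^+ k.

Lemma pospow_ge0 (R : realType) (k : nat) (s : R) : 0 <= pospow k s.
Proof. by rewrite exprn_ge0// le_max lexx. Qed.

Lemma continuous_pospow (R : realType) (k : nat) : continuous (@pospow R k).
Proof.
move=> s; apply: (@continuous_comp _ _ _ (fun s : R => Num.max 0 s) (fun x => x ^+ k)).
  by apply: (@continuous_max R R (cst 0) id); [exact: cst_continuous|].
exact: exprn_continuous.
Qed.

Lemma is_derive_pospow (R : realType) (k : nat) (s : R) :
  is_derive s 1 (@pospow R k.+2) (k.+2%:R * pospow k.+1 s).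
Proof.
have [s0|s0|->] := ltgtP s 0.
- rewrite /pospow (max_idPl (ltW s0)) expr0n/= mulr0.
  apply: (@near_eq_is_derive _ _ _ (cst 0)).
  near=> t; rewrite /cst max_l ?expr0n//.
  by apply/ltW; near: t; exact: lt_nbhsl.
- rewrite /pospow (max_idPr (ltW s0)).
  apply: (@near_eq_is_derive _ _ _ ((id : R -> R) ^+ k.+2)).
    near=> t; rewrite fctE max_r//.
    by apply/ltW; near: t; exact: lt_nbhsr.
  by apply: is_derive_eq; rewrite scaler1.
(* At the origin the difference quotient is max(0, h)^(k+2) / h, of absolute value at most |h| once
   |h| <= 1. *)
- have cv : h^-1 *: ((@pospow R k.+2 \o shift 0) (h *: 1) - pospow k.+2 0)
      @[h --> 0^'] --> (0 : R).
    apply/cvgr0Pnorm_le => e e0; near=> h.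
    have h0 : h != 0 by near: h; exact: nbhs_dnbhs_neq.
    have he : `|h| <= Num.min 1 e.
      apply/ltW; near: h; apply: dnbhs0_lt.
      by rewrite lt_min ltr01.
    rewrite /pospow /= maxxx expr0n/= subr0 addr0 /GRing.scale/= mulr1.
    rewrite normrM normfV ler_pdivrMl ?normr_gt0//.
    move: he; rewrite le_min => /andP[h1 he].
    have mh : `|Num.max 0 h| <= `|h|.
      by case: (lerP 0 h) => // _; rewrite normr0.
    have mk : `|Num.max 0 h| ^+ k <= 1.
      by rewrite exprn_ile1// (le_trans mh).
    have -> : `|Num.max 0 h ^+ k.+2| = `|Num.max 0 h| * (`|Num.max 0 h| * `|Num.max 0 h| ^+ k).
      by rewrite normrX !exprS.
    apply: ler_pM => //.
    rewrite (le_trans _ he)// (le_trans _ mh)//.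
    by rewrite ler_piMr.
  rewrite /pospow maxxx expr0n mulr0.
  by apply: DeriveDef; [apply/cvg_ex; exists 0|exact/cvg_lim].
Unshelve. all: by end_near. Qed.

Definition hump (R : realType) : {poly R} := 'X * (1 - 'X).

(** Leibniz rule with a power of the hump h factored out: where h > 0, the derivative of h^j q is
    h^(j-1) (j h' q + h q'), here with j = m + 1 - k'. *)
Fixpoint bump_poly (R : realType) (m k : nat) : {poly R} :=
  if k is k'.+1 then
    (m.+1 - k')%:R *: ((hump R)^`() * bump_poly R m k') + hump R * (bump_poly R m k')^`()
  else 1.

(* [bump m k] is the [k]-th derivative of [max 0 (t (1 - t)) ^ (m + 1)], for [k <= m]. *)
Definition bump (R : realType) (m k : nat) (t : R) : R :=
  pospow (m.+1 - k) (hump R).[t] * (bump_poly R m k).[t].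

Lemma is_derive_bump (R : realType) (m k : nat) (t : R) :
  (k < m)%N -> is_derive t 1 (@bump R m k) (bump m k.+1 t).
Proof.
move=> km; have [j mj] : exists j, (m - k = j.+1)%N.
  by exists (m - k).-1; rewrite prednK// subn_gt0.
have e1 : (m.+1 - k = j.+2)%N by rewrite subSn ?mj// ltnW.
have e2 : (m.+1 - k.+1 = j.+1)%N by rewrite subSS.
rewrite /bump e1 e2/=.
have D1 := is_derive1_comp (is_derive_pospow j (hump R).[t]) (is_derive_poly (hump R) t).
apply: (is_derive_eq (is_deriveM D1 (is_derive_poly (bump_poly R m k) t))).
rewrite e1 /comp /GRing.scale/= hornerD hornerZ (hornerM _^`()) (hornerM (hump R)).
(* One factor of the hump is split off to match the recursion; where it is negative both sides
   vanish, because j + 1 > 0. *)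
have -> : pospow j.+2 (hump R).[t] = (hump R).[t] * pospow j.+1 (hump R).[t].
  rewrite /pospow exprS; case: (lerP 0 (hump R).[t]) => // _.
  by rewrite expr0n/= !mulr0.
ring.
Qed.

Lemma continuous_bump (R : realType) (m k : nat) : continuous (@bump R m k).
Proof.
move=> t; apply: cvgM; last exact: continuous_horner.
apply: (@continuous_comp _ _ _ (horner (hump R)) (@pospow R _)).
  exact: continuous_horner.
exact: continuous_pospow.
Qed.

Lemma hump_horner (R : realType) (t : R) : (hump R).[t] = t * (1 - t).
Proof. by rewrite /hump !hornerE. Qed.

Lemma bump_out (R : realType) (m k : nat) (t : R) :
  (k <= m)%N -> ~~ (0 < t < 1) -> bump m k t = 0.
Proof.
(* Since k <= m, the exponent m + 1 - k is positive, so the power of 0 is 0 and not 1. *)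
move=> km t01; rewrite /bump /pospow subSn// max_l ?expr0n ?mul0r//.
by rewrite hump_horner; nra.
Qed.

(** [k <= m] stands under the existential so that [choice] yields a bound for every [k] at once. *)
Lemma bump_bounded (R : realType) (m k : nat) :
  exists M : R, forall t, (k <= m)%N -> `|bump m k t| <= M.
Proof.
have [c _ cmax] : exists2 c, c \in `[0 : R, 1] &
    forall t, t \in `[0 : R, 1] -> `|bump m k t| <= `|bump m k c|.
  apply: EVT_max; first exact: ler01.
  apply: continuous_subspaceT => t.
  by apply: cvg_norm; exact: continuous_bump.
exists `|bump m k c| => t km; have [t01|t01] := boolP (0 < t < 1).
  by apply: cmax; rewrite in_itv/=; lra.
by rewrite bump_out// normr0.
Qed.

Lemma bump_bounded_le (R : realType) (m : nat) :
  exists2 M : R, 1 <= M & forall k t, (k <= m)%N -> `|bump m k t| <= M.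
Proof.
have /choice[M hM] := @bump_bounded R m.
exists (1 + \sum_(k < m.+1) `|M k|) => [|k t km].
  by rewrite lerDl sumr_ge0.
apply: (le_trans (hM k t km)); apply: (le_trans (ler_norm _)).
rewrite (bigD1 (Ordinal (km : (k < m.+1)%N)))//=.
by rewrite addrCA lerDl addr_ge0// sumr_ge0.
Qed.

Lemma bump_ge0 (R : realType) (m : nat) (t : R) : 0 <= bump m 0 t.
Proof. by rewrite /bump hornerC mulr1 pospow_ge0. Qed.

Lemma bump_ge (R : realType) (m : nat) (t : R) :
  4^-1 <= t <= 3 / 4 -> (8^-1) ^+ m.+1 <= bump m 0 t.
Proof.
move=> t14; rewrite /bump hornerC mulr1 subn0 /pospow.
(* On [1/4, 3/4] the product t (1 - t) is at least 3/16. *)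
have h8 : 8^-1 <= (hump R).[t] by rewrite hump_horner; nra.
apply: lerXn2r; rewrite ?nnegrE ?invr_ge0//.
  by rewrite le_max lexx.
by rewrite le_max h8 orbT.
Qed.

(** * Partial derivatives of separable functions *)

(** [G i k] stands for the k-th derivative of the i-th factor. A mixed partial derivative depends
    only on how often each index occurs in [l], which gives all of them one closed form. *)
Definition sepfun (R : realType) (d : nat) (a : R) (G : 'I_d -> nat -> R -> R)
    (l : seq 'I_d) (v : 'rV[R]_d) : R :=
  a * \prod_(i < d) G i (count_mem i l) (v ord0 i).

Lemma is_derive_sepfun (R : realType) (d : nat) (a : R) (G : 'I_d -> nat -> R -> R)
    (l : seq 'I_d) (v : 'rV[R]_d) (i : 'I_d) :
  is_derive (v ord0 i) 1 (G i (count_mem i l)) (G i (count_mem i l).+1 (v ord0 i)) ->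
  is_derive v (@unit_vec R d i) (sepfun a G l) (sepfun a G (i :: l) v).
Proof.
move=> DG; pose C := a * \prod_(j < d | j != i) G j (count_mem j l) (v ord0 j).
have sepE (u : 'rV[R]_d) : (forall j, j != i -> u ord0 j = v ord0 j) ->
    sepfun a G l u = C * G i (count_mem i l) (u ord0 i).
  move=> uv; rewrite /sepfun (bigD1 i)//= /C -mulrA; congr (_ * _).
  by rewrite mulrC; congr (_ * _); apply: eq_bigr => j ji; rewrite uv.
have dE : sepfun a G (i :: l) v = C * G i (count_mem i l).+1 (v ord0 i).
  rewrite /sepfun (bigD1 i)//= eqxx add1n /C -mulrA; congr (_ * _).
  rewrite mulrC; congr (_ * _); apply: eq_bigr => j ji.
  by rewrite [i == j]eq_sym (negbTE ji).
(* Moving along the i-th axis freezes the other factors, so the two difference quotients are the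
   same function of h and the one-dimensional limit carries over. *)
have qE : (fun h : R => h^-1 *: ((sepfun a G l \o shift v) (h *: unit_vec R i) - sepfun a G l v))
   = (fun h : R => h^-1 *: (((C \*: G i (count_mem i l)) \o shift (v ord0 i)) (h *: 1)
        - (C \*: G i (count_mem i l)) (v ord0 i))).
  apply/funext => h /=; rewrite !sepE//; last first.
    by move=> j ji; rewrite !mxE eqxx/= (negbTE ji) mulr0 add0r.
  by rewrite !mxE !eqxx /= /GRing.scale/= !mulr1.
have [dC eC] := is_deriveZ C DG.
rewrite dE; apply: DeriveDef; first by rewrite /derivable qE.
by rewrite -[RHS]eC /derive qE.
Qed.

Lemma pderiv_sepfun (R : realType) (d m : nat) (a : R) (G : 'I_d -> nat -> R -> R)
    (l : seq 'I_d) :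
  (forall i k (t : R), (k < m)%N -> is_derive t 1 (G i k) (G i k.+1 t)) ->
  (size l <= m)%N -> pderiv l (sepfun a G [::]) = sepfun a G l.
Proof.
move=> DG; elim: l => [|i l IHl] //= lm.
rewrite IHl ?(ltnW lm)//; apply/funext => v; apply: derive_val.
apply: is_derive_sepfun; apply: DG.
by rewrite (leq_ltn_trans (count_size _ _)).
Qed.

Lemma Cm_sepfun (R : realType) (d m : nat) (a : R) (G : 'I_d -> nat -> R -> R) :
  (forall i k (t : R), (k < m)%N -> is_derive t 1 (G i k) (G i k.+1 t)) ->
  (forall i k, (k <= m)%N -> continuous (G i k)) ->
  Cm m (sepfun a G [::]).
Proof.
move=> DG cG l lm; rewrite (pderiv_sepfun a DG lm); split.
  move=> v; apply: (@continuous_comp _ _ _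
    (fun v : 'rV[R]_d => \prod_(i < d) G i (count_mem i l) (v ord0 i)) ( *%R a)); last first.
    exact: mulrl_continuous.
  apply: (@continuous_big R _ *%R 1 xpredT).
    exact: mul_continuous.
  move=> i _ u.
  apply: (@continuous_comp _ _ _ (fun u : 'rV[R]_d => u ord0 i) (G i _)).
    exact: coord_continuous.
  by apply: cG; exact: leq_trans (count_size _ _) lm.
move=> {}lm i v; apply: ex_derive; apply: is_derive_sepfun; apply: DG.
by rewrite (leq_ltn_trans (count_size _ _)).
Qed.

(** * Rescaled bumps on small cells *)

(** For K > 0 this is supported in the cell of side 1 / K with lowest corner s / K. *)
Definition cell_bump (R : realType) (d m : nat) (a K : R) (s : 'I_d -> R)
    (x : d.-tuple R) : R :=
  a * \prod_(i < d) bump m 0 (K * tnth x i - s i).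

Definition scaled_bump (R : realType) (d m : nat) (K : R) (s : 'I_d -> R)
    (i : 'I_d) (k : nat) (t : R) : R :=
  K ^+ k * bump m k (K * t - s i).

Lemma is_derive_scaled_bump (R : realType) (d m : nat) (K : R) (s : 'I_d -> R)
    (i : 'I_d) (k : nat) (t : R) : (k < m)%N ->
  is_derive t 1 (scaled_bump m K s i k) (scaled_bump m K s i k.+1 t).
Proof.
move=> km; pose p : {poly R} := K *: 'X - (s i)%:P.
have pE u : p.[u] = K * u - s i by rewrite /p !hornerE.
have Dp := is_derive_poly p t.
have -> : scaled_bump m K s i k = K ^+ k \*: (@bump R m k \o horner p).
  by apply/funext => u; rewrite /scaled_bump /= pE.
apply: (is_derive_eq (is_deriveZ _ (is_derive1_comp (is_derive_bump _ km) Dp))).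
have -> : p^`().[t] = K.
  by rewrite /p derivB derivZ derivX derivC subr0 hornerZ hornerC mulr1.
by rewrite pE /scaled_bump exprSr /GRing.scale/= mulrA mulrAC.
Qed.

Lemma continuous_scaled_bump (R : realType) (d m : nat) (K : R) (s : 'I_d -> R)
    (i : 'I_d) (k : nat) : continuous (scaled_bump m K s i k).
Proof.
move=> t; apply: cvgM; first exact: cvg_cst.
apply: (@continuous_comp _ _ _ (fun u : R => K * u - s i) (@bump R m k)).
  by apply: cvgB; [apply: cvgM; [exact: cvg_cst|exact: cvg_id]|exact: cvg_cst].
exact: continuous_bump.
Qed.

Lemma sum_count_mem (T : finType) (l : seq T) : (\sum_(i : T) count_mem i l = size l)%N.
Proof.
elim: l => [|x l IHl] /=; first by rewrite big1.
by rewrite big_split/= IHl (bigD1 x)//= eqxx big1 ?addn0// => i; rewrite eq_sym => /negbTE ->.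
Qed.

(** By the chain rule a derivative of order |l| costs K^|l|, which is at most K^m as K >= 1; each of
    the [d] factors is at most [M]. Hence the amplitude may be of order B / K^m. *)
Lemma Fclass_cell_bump (R : realType) (d m : nat) (a K M B : R) (s : 'I_d -> R) :
  0 <= a -> 1 <= K -> (forall k t, (k <= m)%N -> `|bump m k t| <= M) ->
  a * (K ^+ m * M ^+ d) <= B ->
  Fclass m B (cell_bump m a K s).
Proof.
move=> a0 K1 hM aB.
have sE : (fun v => cell_bump m a K s (rv2t v)) = sepfun a (scaled_bump m K s) [::].
  apply/funext => v; rewrite /cell_bump /sepfun; congr (_ * _).
  by apply: eq_bigr => i _; rewrite /scaled_bump tnth_mktuple expr0 mul1r.
have DG i k t := @is_derive_scaled_bump R d m K s i k t.
have M0 : 0 <= M by apply: le_trans (hM 0%N 0 (leq0n m)).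
split; rewrite sE.
  by apply: (Cm_sepfun a DG) => i k _; exact: continuous_scaled_bump.
move=> l lm v _; rewrite (pderiv_sepfun a DG lm) /sepfun normrM (ger0_norm a0).
apply: le_trans aB; apply: ler_wpM2l => //; rewrite normr_prod.
apply: (@le_trans _ _ (\prod_(i < d) (K ^+ count_mem i l * M))).
  apply: ler_prod => i _; rewrite normr_ge0/= /scaled_bump normrM ger0_norm; last first.
    by rewrite exprn_ge0// (le_trans ler01).
  apply: ler_wpM2l; first by rewrite exprn_ge0// (le_trans ler01).
  by apply: hM; exact: leq_trans (count_size _ _) lm.
rewrite big_split/= prodr_const card_ord ler_wpM2r ?exprn_ge0//.
by rewrite -expr_sum sum_count_mem ler_weXn2l.
Qed.

Lemma Fclass0 (R : realType) (d m : nat) (B : R) :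
  0 <= B -> @Fclass R d m B (fun=> 0).
Proof.
move=> B0; have [M _ hM] := bump_bounded_le R m.
have -> : (fun=> 0) = @cell_bump R d m 0 1 (fun=> 0).
  by apply/funext => x; rewrite /cell_bump mul0r.
by apply: (Fclass_cell_bump _ _ _ hM) => //; rewrite mul0r.
Qed.

Lemma cell_bump_neq0 (R : realType) (d m : nat) (a K : R) (s : 'I_d -> R)
    (x : d.-tuple R) (i : 'I_d) :
  cell_bump m a K s x != 0 -> s i < K * tnth x i < s i + 1.
Proof.
move=> fx; have : bump m 0 (K * tnth x i - s i) != 0.
  apply: contra_neq fx => b0.
  by rewrite /cell_bump (bigD1 i)//= b0 mul0r mulr0.
by case: (boolP (0 < K * tnth x i - s i < 1)) => [|/(bump_out (leq0n m)) ->]; lra.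
Qed.

Lemma cell_bump_le (R : realType) (d m : nat) (a K : R) (s : 'I_d -> R) :
  0 <= a -> exists C, forall x, cell_bump m a K s x <= C.
Proof.
move=> a0; have [M _ hM] := bump_bounded_le R m.
exists (a * M ^+ d) => x; apply: ler_wpM2l => //.
rewrite -[X in M ^+ X](card_ord d) -prodr_const; apply: ler_prod => i _.
by rewrite bump_ge0 (le_trans (ler_norm _))// hM.
Qed.

(** The integral is restricted to the middle half of the cell, a cube of side 1 / (2 K) on which
    every factor is at least 8^-(m+1). *)
Lemma Zf_cell_bump (R : realType) (d m : nat) (a K : R) (s : 'I_d -> R) :
  0 <= a -> 0 < K -> (forall i, 0 <= s i /\ s i + 1 <= K) ->
  ((expR (a * ((8^-1) ^+ m.+1) ^+ d) / (2 * K) ^+ d)%:E <= Zf (cell_bump m a K s))%E.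
Proof.
move=> a0 K0 sK; rewrite -exprVn.
apply: (@cube_integral_ge_box _ _ _ (fun i => (s i + 4^-1) / K)).
- exact: expR_ge0.
- by rewrite invr_ge0 mulr_ge0// ltW.
- by move=> x; rewrite lee_fin expR_ge0.
- move=> i; have [s0 s1] := sK i; split; first by rewrite divr_ge0 ?ltW//; lra.
  by rewrite invfM -mulrDl ler_pdivrMr//; lra.
- move=> x xb; rewrite lee_fin ler_expR ler_wpM2l//.
  rewrite -[X in _ ^+ X](card_ord d) -prodr_const; apply: ler_prod => i _.
  rewrite exprn_ge0 ?invr_ge0//=; apply: bump_ge.
  have := xb i; rewrite invfM -mulrDl ler_pdivrMr// ler_pdivlMr//.
  by rewrite mulrC; lra.
Qed.

(** * Fooling an algorithm with disjoint bumps *)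

(* The queries need not be measurable in [w]; averaging the measurable events
   [X_0 \in H, X_i \notin H] instead of "bump [i] is queried" avoids the issue. *)
Lemma fooling (R : realType) (d n : nat) (dO : measure_display)
    (Omega : measurableType dO) (P : probability Omega R) (A : stoch_alg R d Omega)
    (I : finType) (f : I -> d.-tuple R -> R) (H : set (d.-tuple R)) :
  measurable H ->
  (forall i, measurable_fun setT (sample A n (f i))) ->
  measurable_fun setT (sample A n (fun=> 0)) ->
  (forall x i j, f i x != 0 -> f j x != 0 -> i = j) ->
  (0 < #|I|)%N -> (4 * n <= #|I|)%N ->
  (2^-1%:E <= P (sample A n (fun=> 0%R) @^-1` H))%E ->
  exists i, (4^-1%:E <= P (sample A n (f i) @^-1` H))%E.
Proof.
move=> mH mf m0 fdisj I0 In X0H.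
pose X0 := sample A n (fun=> 0).
pose N i := X0 @^-1` H `\` sample A n (f i) @^-1` H.
have mX i : measurable (sample A n (f i) @^-1` H).
  by rewrite -[X in measurable X]setTI; exact: mf.
have mX0 : measurable (X0 @^-1` H) by rewrite -[X in measurable X]setTI; exact: m0.
have mN i : measurable (N i) by exact: measurableD.
have cardN w : (#|[pred i | w \in N i]| <= n)%N.
  apply: (card_sample_neq (A := A) (w := w) fdisj) => i.
  rewrite !inE => -[H0 H1]; apply/eqP => e; apply: H1.
  by rewrite /= e.
have nI : n%:R <= 4^-1 * #|I|%:R :> R.
  by rewrite ler_pdivlMl// -natrM ler_nat.
have [i Ni] := exists_measure_le_mean P mN cardN I0 nI.
(* The sample for 0 lies in [H] with probability at least 1/2, and at most 1/4 of that is lost to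
   [N i]. *)
exists i; have : (P (X0 @^-1` H) <= P (N i) + P (sample A n (f i) @^-1` H))%E.
  apply: (le_trans _ (measureU2 P (mN i) (mX i))).
  apply: le_measure; rewrite ?inE//; first exact: measurableU.
  by move=> w Hw; case: (pselect ((sample A n (f i) @^-1` H) w)); [right|left].
move: Ni X0H; rewrite -/X0.
rewrite -(fineK (fin_num_measure P _ (mN i))) -(fineK (fin_num_measure P _ (mX i))).
rewrite -(fineK (fin_num_measure P _ mX0)) -EFinD !lee_fin; lra.
Qed.

(** * Lower bounds for the three distances *)

Lemma D_TV_ge (R : realType) (d : nat) (P Q : set (d.-tuple R) -> \bar R)
    (A : set (d.-tuple R)) (p q : R) :
  measurable A -> (0 <= P A <= p%:E)%E -> (q%:E <= Q A <= 1%:E)%E ->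
  ((q - p)%:E <= D_TV P Q)%E.
Proof.
move=> mA /andP[P0 Pp] /andP[qQ Q1].
apply: (@le_trans _ _ `|P A - Q A|%E); last by apply: ereal_sup_ubound; exists A.
move: (P A) (Q A) P0 Pp qQ Q1 => [x| |] [y| |]//=; rewrite ?lee_fin => *.
by rewrite ler_normr; apply/orP; right; lra.
Qed.

(** In any coupling, pairs with y in [A] and x outside [A'] carry mass at least q - p, and each of
    them is at distance at least [e]. *)
Lemma W1_ge (R : realType) (d : nat) (P Q : set (d.-tuple R) -> \bar R)
    (A A' : set (d.-tuple R)) (p q e : R) :
  measurable A -> measurable A' -> (P A' <= p%:E)%E -> (q%:E <= Q A)%E ->
  0 <= e -> (forall x y, ~ A' x -> A y -> e <= eucl_dist x y) ->
  ((e * (q - p))%:E <= W1 P Q)%E.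
Proof.
move=> mA mA' Pp qQ e0 dist_ge; apply: le_ereal_inf_tmp => _ [g gPQ <-].
have [gP _] := gPQ _ mA'; have [_ gQ] := gPQ _ mA.
have mE : measurable (~` A' `*` A) by apply: measurableX => //; exact: measurableC.
have mTA : measurable (setT `*` A : set (d.-tuple R * d.-tuple R)) by exact: measurableX.
have mAT : measurable (A' `*` setT : set (d.-tuple R * d.-tuple R)) by exact: measurableX.
have gE : ((q - p)%:E <= g (~` A' `*` A))%E.
  have : (g (setT `*` A) <= g (~` A' `*` A) + g (A' `*` setT))%E.
    apply: (le_trans _ (measureU2 g mE mAT)).
    apply: le_measure; rewrite ?inE//; first exact: measurableU.
    move=> [x y] [_ /= Ay]; case: (pselect (A' x)) => A'x; [by right|by left].
  move: Pp qQ; rewrite -gP -gQ.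
  rewrite -(fineK (fin_num_measure g _ mE)) -(fineK (fin_num_measure g _ mTA)).
  rewrite -(fineK (fin_num_measure g _ mAT)) -EFinD !lee_fin; lra.
apply: (@le_trans _ _ (\int[g]_z (e%:E * (\1_(~` A' `*` A) z)%:E))%E).
  rewrite ge0_integralZl_EFin//; last first.
    by apply/measurable_EFinP; exact: measurable_indic.
  by rewrite integral_indic// setIT EFinM; apply: lee_wpmul2l.
apply: ge0_le_integral_nomeas => -[x y] _.
  by rewrite -EFinM lee_fin mulr_ge0.
rewrite -EFinM lee_fin indicE; case: (boolP (_ \in _)) => [|_].
  by rewrite inE => -[/= A'x Ay]; rewrite mulr1; exact: dist_ge.
by rewrite mulr0 sqrtr_ge0.
Qed.

(** A density [h] with |ln h| <= c almost everywhere satisfies h >= e^(-c), so e^(-c) q <= P(A) <=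
    e^(-t); taking logarithms gives c >= t + ln q. *)
Lemma D_suplog_ge (R : realType) (d : nat) (dO : measure_display)
    (Omega : measurableType dO) (POm : probability Omega R)
    (X : Omega -> d.-tuple R) (P : set (d.-tuple R) -> \bar R)
    (A : set (d.-tuple R)) (t q : R) :
  measurable_fun setT X -> measurable A -> 0 < q ->
  (P A <= (expR (- t))%:E)%E -> (q%:E <= pushforward POm X A)%E ->
  ((t + ln q)%:E <= D_suplog P (pushforward POm X))%E.
Proof.
move=> mX mA q0 Pt qA; apply: le_ereal_inf_tmp => _ [c [h [mh h0 hP hc]] <-].
rewrite lee_fin.
have [N [mN N0 hN]] := hc.
have mXA : measurable (X @^-1` A) by rewrite -[Y in measurable Y]setTI; exact: mX.
have mXN : measurable (X @^-1` N) by rewrite -[Y in measurable Y]setTI; exact: mX.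
have : ((expR (- c))%:E * POm (X @^-1` A) <= P A)%E.
  rewrite hP// (ge0_integral_pushforward mX)//; last 2 first.
  - by apply/measurable_EFinP; exact: measurable_funS mh.
  - by move=> x _; rewrite lee_fin ltW.
  (* The bound on [h] holds only off the null set [N]; its preimage is removed without changing the
     mass. *)
  have <- : POm (X @^-1` A `\` X @^-1` N) = POm (X @^-1` A).
    have AN0 : POm (X @^-1` A `&` X @^-1` N) = 0%E.
      apply/eqP; rewrite eq_le measure_ge0 andbT -[leRHS]N0.
      by apply: le_measure; rewrite ?inE//; exact: measurableI.
    by rewrite [RHS](measureDI POm mXA mXN) [X in (_ + X)%E]AN0 adde0.
  rewrite -integral_cst; last exact: measurableD.
  rewrite integral_mkcond [leRHS]integral_mkcond.
  apply: ge0_le_integral_nomeas => w _.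
    by apply: erestrict_ge0 => ? _; rewrite lee_fin expR_ge0.
  rewrite !patchE; case: ifPn => [|_]; last first.
    by case: ifPn => // _; rewrite lee_fin ltW.
  rewrite inE => -[Aw Nw]; rewrite mem_set// lee_fin.
  rewrite -[leRHS]lnK ?posrE// ler_expR.
  suff : `|ln (h (X w))| <= c by rewrite ler_norml => /andP[].
  by apply: contrapT => hw; apply: Nw; exact: hN.
have AE := fineK (fin_num_measure POm _ mXA).
move: qA; rewrite /pushforward -AE lee_fin => qA.
rewrite -EFinM => /le_trans /(_ Pt); rewrite lee_fin => le1.
have qE : q = expR (ln q) by rewrite lnK ?posrE.
have : expR (- c) * q <= expR (- t) by apply: le_trans le1; rewrite ler_wpM2l.
by rewrite {1}qE -expRD ler_expR; lra.
Qed.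

(** * Half-spaces and grids of bumps *)

Lemma eucl_dist_ge (R : realType) (d : nat) (x y : d.-tuple R) (i : 'I_d) :
  `|tnth x i - tnth y i| <= eucl_dist x y.
Proof.
rewrite -sqrtr_sqr ler_wsqrtr// (bigD1 i)//= lerDl.
by apply: sumr_ge0 => j _; exact: sqr_ge0.
Qed.

Definition halfspace (R : realType) (d : nat) (i : 'I_d) (b : bool) : set (d.-tuple R) :=
  [set x | if b then 2^-1 < tnth x i else tnth x i <= 2^-1].

(** The half-space enlarged by 1/6, up to the corner that holds the bumps; the gap is the distance
    that transport has to cover in [W1]. *)
Definition wide_halfspace (R : realType) (d : nat) (i : 'I_d) (b : bool) : set (d.-tuple R) :=
  [set x | if b then 3^-1 < tnth x i else tnth x i < 2 / 3].

Lemma measurable_halfspace (R : realType) (d : nat) (i : 'I_d) (b : bool) :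
  measurable (@halfspace R d i b).
Proof.
have -> : @halfspace R d i b = setT `&` (fun x => tnth x i) @^-1`
    (if b then `]2^-1, +oo[ else `]-oo, 2^-1])%classic.
  by apply/seteqP; split=> x /=; case: b => /=; rewrite !in_itv/= ?andbT// => -[].
by apply: measurable_tnth => //; case: b.
Qed.

Lemma measurable_wide_halfspace (R : realType) (d : nat) (i : 'I_d) (b : bool) :
  measurable (@wide_halfspace R d i b).
Proof.
have -> : @wide_halfspace R d i b = setT `&` (fun x => tnth x i) @^-1`
    (if b then `]3^-1, +oo[ else `]-oo, 2 / 3[)%classic.
  by apply/seteqP; split=> x /=; case: b => /=; rewrite !in_itv/= ?andbT// => -[].
by apply: measurable_tnth => //; case: b.
Qed.

Lemma halfspace_sub_wide (R : realType) (d : nat) (i : 'I_d) (b : bool) :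
  @halfspace R d i b `<=` wide_halfspace i b.
Proof. by move=> x; rewrite /halfspace /wide_halfspace /=; case: b; lra. Qed.

Lemma eucl_dist_halfspace (R : realType) (d : nat) (i : 'I_d) (b : bool) (x y : d.-tuple R) :
  ~ wide_halfspace i b x -> halfspace i b y -> 6^-1 <= eucl_dist x y.
Proof.
move=> xw yh; apply: le_trans (eucl_dist_ge x y i); move: xw yh.
rewrite /halfspace /wide_halfspace /= ler_normr; case: b => /negP; rewrite -leNgt => xw yh.
  by apply/orP; right; lra.
by apply/orP; left; lra.
Qed.

(* The grid of mesh 1 / (12 r) in [0, 1/3]^d for [b = true], in [2/3, 1]^d otherwise. *)
Definition grid_bump (R : realType) (d m r : nat) (a : R) (b : bool)
    (s : {ffun 'I_d -> 'I_(4 * r)}) : d.-tuple R -> R :=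
  cell_bump m a (12 * r)%:R (fun i => (s i + if b then 0 else 8 * r)%:R).

Lemma grid_bump_disjoint (R : realType) (d m r : nat) (a : R) (b : bool)
    (x : d.-tuple R) (s s' : {ffun 'I_d -> 'I_(4 * r)}) :
  grid_bump m a b s x != 0 -> grid_bump m a b s' x != 0 -> s = s'.
Proof.
move=> sx s'x; apply/ffunP => i; apply/val_inj => /=.
have := cell_bump_neq0 i sx; have := cell_bump_neq0 i s'x; rewrite !natrD => H1 H2.
have [] : (s i)%:R < (s' i)%:R + 1 :> R /\ (s' i)%:R < (s i)%:R + 1 :> R by lra.
rewrite !natr1 !ltr_nat !ltnS => ss' s's.
by apply/eqP; rewrite eqn_leq ss'.
Qed.

(** A product of bumps vanishes as soon as one coordinate leaves the corner, so the single
    coordinate [i] decides. *)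
Lemma grid_bump_wide_halfspace (R : realType) (d m r : nat) (a : R) (b : bool) (i : 'I_d)
    (s : {ffun 'I_d -> 'I_(4 * r)}) (x : d.-tuple R) :
  wide_halfspace i b x -> grid_bump m a b s x = 0.
Proof.
move=> xw; apply/eqP; apply: contraT => /(cell_bump_neq0 i).
have : (s i)%:R + 1 <= (4 * r)%:R :> R by rewrite natr1 ler_nat.
have s0 : 0 <= (s i)%:R :> R by [].
have r0 : 0 <= r%:R :> R by [].
move: xw; rewrite /wide_halfspace /= !natrM natrD; case: b => /= xw sr /andP[H1 H2]; exfalso.
  have : 0 <= r%:R * (tnth x i - 3^-1) by apply: mulr_ge0 => //; lra.
  by rewrite mulrDr; lra.
have : 0 <= r%:R * (2 / 3 - tnth x i) by apply: mulr_ge0 => //; lra.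
by move: H1; rewrite natrM mulrDr; lra.
Qed.

Lemma Zf_grid_bump (R : realType) (d m r : nat) (a : R) (b : bool)
    (s : {ffun 'I_d -> 'I_(4 * r)}) : (0 < r)%N -> 0 <= a ->
  ((expR (a * ((8^-1) ^+ m.+1) ^+ d) / (24 * r%:R) ^+ d)%:E
     <= Zf (grid_bump m a b s))%E.
Proof.
move=> r0 a0.
have -> : 24 * r%:R = 2 * (12 * r)%:R :> R by rewrite natrM; ring.
apply: Zf_cell_bump => // [|i]; first by rewrite ltr0n muln_gt0.
split=> //; rewrite natr1 ler_nat.
have := ltn_ord (s i); case: b; first by rewrite addn0; lia.
by lia.
Qed.

(** * A hard function for a given algorithm *)

(** One function and one half-space serve all three distances. The lower bound [z] on the
    normalising constant stays free, to be chosen once the constants are fixed. *)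
Lemma hard_instance (R : realType) (d m r n : nat) (i0 : 'I_d) (a M B : R)
    (dO : measure_display) (Omega : measurableType dO) (POm : probability Omega R)
    (A : stoch_alg R d Omega) :
  (0 < r)%N -> (n <= r ^ d)%N -> 0 <= a -> 0 <= B ->
  (forall k t, (k <= m)%N -> `|bump m k t| <= M) ->
  a * ((12 * r)%:R ^+ m * M ^+ d) <= B ->
  (forall f, Fclass m B f -> measurable_fun setT (sample A n f)) ->
  exists f b, [/\ Fclass m B f,
    (4^-1%:E <= pushforward POm (sample A n f) (halfspace i0 b))%E &
    forall z, 0 < z -> z <= expR (a * ((8^-1) ^+ m.+1) ^+ d) / (24 * r%:R) ^+ d ->
      (0 <= Pf f (halfspace i0 b) <= z^-1%:E)%E /\ (Pf f (wide_halfspace i0 b) <= z^-1%:E)%E].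
Proof.
move=> r0 nr a0 B0 hM aB mA.
have F0 : Fclass m B (fun=> 0 : R) := Fclass0 d m B0.
have Fg b s : Fclass m B (@grid_bump R d m r a b s).
  apply: (Fclass_cell_bump _ a0 _ hM aB).
  by rewrite ler1n muln_gt0.
(* The two half-spaces cover the space, so one of them receives at least half of the samples for 0;
   the bumps go to the opposite corner. *)
have [b hb] : exists b, (2^-1%:E <= POm (sample A n (fun=> 0%R) @^-1` halfspace i0 b))%E.
  have mh b : measurable (sample A n (fun=> 0) @^-1` @halfspace R d i0 b).
    by rewrite -[X in measurable X]setTI; apply: mA => //; exact: measurable_halfspace.
  have : (1 <= POm (sample A n (fun=> 0%R) @^-1` halfspace i0 true) +
               POm (sample A n (fun=> 0%R) @^-1` halfspace i0 false))%E.
    rewrite -(probability_setT POm); apply: (le_trans _ (measureU2 POm (mh true) (mh false))).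
    apply: le_measure; rewrite ?inE//; first exact: measurableU.
    by move=> w _; rewrite /halfspace /setU /=; case: ltP; [left|right].
  rewrite -(fineK (fin_num_measure POm _ (mh true))) -(fineK (fin_num_measure POm _ (mh false))).
  rewrite -EFinD lee_fin => h1.
  have [h|h] := lerP 2^-1 (fine (POm (sample A n (fun=> 0) @^-1` halfspace i0 true))).
    by exists true; rewrite -(fineK (fin_num_measure POm _ (mh true))) lee_fin.
  by exists false; rewrite -(fineK (fin_num_measure POm _ (mh false))) lee_fin; lra.
have d0 : (0 < d)%N by exact: leq_ltn_trans (ltn_ord i0).
have card_grid : #|{ffun 'I_d -> 'I_(4 * r)}| = ((4 * r) ^ d)%N by rewrite card_ffun !card_ord.
have [s hs] : exists s,
    (4^-1%:E <= POm (sample A n (@grid_bump R d m r a b s) @^-1` halfspace i0 b))%E.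
  apply: fooling hb => //.
  - exact: measurable_halfspace.
  - by move=> s; apply: mA.
  - exact: mA.
  - by move=> x s s'; exact: grid_bump_disjoint.
  - by rewrite card_grid expn_gt0 muln_gt0 r0.
  (* (4 r)^d = 4^d r^d >= 4 n, since d >= 1. *)
  - by rewrite card_grid expnMn leq_mul// -[leqLHS]expn1 leq_exp2l.
exists (grid_bump m a b s), b; split=> // z z0 zle.
have zZ : (z%:E <= Zf (grid_bump m a b s))%E.
  by apply: le_trans (Zf_grid_bump m b s r0 a0); rewrite lee_fin.
have [C fC] := @cell_bump_le R d m a (12 * r)%:R (fun i => (s i + if b then 0 else 8 * r)%:R) a0.
have Pf_small H : H `<=` wide_halfspace i0 b ->
    (0 <= Pf (grid_bump m a b s) H <= z^-1%:E)%E.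
  move=> Hw; apply: (@Pf_le _ _ (grid_bump m a b s) _ _ _ fC _ z0 zZ) => x /Hw xw.
  by rewrite (grid_bump_wide_halfspace m a s xw).
split; first by apply: Pf_small; exact: halfspace_sub_wide.
by have /andP[] := Pf_small _ (@subset_refl _ (wide_halfspace i0 b)).
Qed.

(** * Choice of the mesh and of the constants *)

(** The least [r] with n <= r^d works: if r >= 2 then r <= 2 (r - 1), while (r - 1)^d < n by
    minimality. *)
Lemma exists_root_upper (d n : nat) : (0 < d)%N -> (0 < n)%N ->
  exists r, [/\ (0 < r)%N, (n <= r ^ d)%N & (r ^ d <= 2 ^ d * n)%N].
Proof.
move=> d0 n0; have ex : exists r, (n <= r ^ d)%N.
  by exists n; rewrite -[leqLHS]expn1 leq_pexp2l.
case: (ex_minnP ex) => r nr rmin; exists r.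
have r0 : (0 < r)%N.
  by case: r nr {rmin} => //; rewrite exp0n// leqn0 => /eqP n0'; rewrite n0' in n0.
split=> //; have [r1|r1] := leqP r 1.
  by rewrite (eqP (_ : r == 1%N)) ?exp1n ?muln_gt0 ?expn_gt0//; rewrite eqn_leq r1.
have lt_n : (r.-1 ^ d < n)%N by rewrite ltnNge; apply/negP => /rmin; lia.
apply: (@leq_trans ((2 * r.-1) ^ d)); first by rewrite leq_exp2r//; lia.
by rewrite expnMn leq_mul2l (ltnW lt_n) orbT.
Qed.

Lemma root_upper_powR (R : realType) (d m n r : nat) : (0 < d)%N ->
  (r ^ d <= 2 ^ d * n)%N -> r%:R ^+ m <= 2 ^+ m * (n%:R `^ (m%:R / d%:R)) :> R.
Proof.
move=> d0 rn; have dn0 : d%:R != 0 :> R by rewrite pnatr_eq0 -lt0n.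
have e0 : 0 <= m%:R / d%:R :> R by rewrite divr_ge0.
have root (x : R) : 0 <= x -> x ^+ m = (x ^+ d) `^ (m%:R / d%:R).
  by move=> x0; rewrite -!powR_mulrn// -powRrM mulrC divfK.
rewrite !root// -powRM ?exprn_ge0//.
by rewrite ge0_ler_powR ?nnegrE ?mulr_ge0 ?exprn_ge0// -!natrX -natrM ler_nat.
Qed.

Lemma err_ad_stoch_ge (R : realType) (d n : nat) (F : set (d.-tuple R -> R))
    (D : (set (d.-tuple R) -> \bar R) -> (set (d.-tuple R) -> \bar R) -> \bar R)
    (c : R) :
  (forall (dO : measure_display) (Omega : measurableType dO)
      (POm : probability Omega R) (A : stoch_alg R d Omega),
    (forall f, F f -> measurable_fun setT (sample A n f)) ->
    exists2 f, F f & (c%:E <= D (Pf f) (pushforward POm (sample A n f)))%E) ->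
  (c%:E <= err_ad_stoch n F D)%E.
Proof.
move=> h; apply: le_ereal_inf_tmp => _ [dO [Om [POm [A [mA ->]]]]].
have [f Ff cf] := h dO Om POm A mA.
by apply: (le_trans cf); apply: ereal_sup_ubound; exists f.
Qed.

Theorem theorem10 (R : realType) (d m : nat) :
  (0 < d)%N -> (0 < m)%N ->
  exists c : R, 0 < c /\
  exists c1 c2 c3 : R, [/\ 0 < c1, 0 < c2 & 0 < c3] /\
  forall (B : R) (n : nat), 0 < B -> (0 < n)%N ->
    c * (1 + ln (n%:R : R)) <= B * (n%:R `^ (- (m%:R / d%:R))) ->
    [/\ ((c1 * (B * (n%:R `^ (- (m%:R / d%:R)))))%:E
           <= err_ad_stoch n (@Fclass R d m B) (@D_suplog R d))%E,
        (c2%:E <= err_ad_stoch n (@Fclass R d m B) (@D_TV R d))%E &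
        (c3%:E <= err_ad_stoch n (@Fclass R d m B) (@W1 R d))%E].
Proof.
move=> d0 m0; have [M M1 hM] := bump_bounded_le R m.
have M0 : 0 < M by apply: lt_le_trans M1.
pose k : R := ((8^-1) ^+ m.+1) ^+ d.
have k0 : 0 < k by rewrite !exprn_gt0// invr_gt0.
(* [k] bounds a product of [d] bumps from below on the middle of a cell. The factor 24 is 12 * 2,
   from the mesh 1 / (12 r) and r <= 2 n^(1/d); thus g T will bound the exponent a k from below. *)
pose g : R := k / (24 ^+ m * M ^+ d).
have g0 : 0 < g by rewrite divr_gt0// mulr_gt0// exprn_gt0.
(* The volume factor satisfies (24 r)^d <= 48^d n, whose logarithm is L + ln n. *)
pose L : R := ln (48 ^+ d).
have L0 : 0 <= L by rewrite ln_ge0// exprn_ege1// ler1n.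
(* With this constant the assumption reads (L + 8) (1 + ln n) <= g T / 2, which exceeds L + 8 + ln n
   as L + 8 >= 1. *)
exists (2 / g * (L + 8)); split.
  by apply: mulr_gt0; [exact: divr_gt0|rewrite ltr_wpDl].
(* Half of the exponent g T survives the volume factor. The half-space has mass at least 1/4 for the
   sample and at most 1/8 for the target, a gap of 1/8; transport across it covers 1/6. *)
exists (g / 2), 8^-1, (6^-1 * 8^-1); split.
  by split; [exact: divr_gt0|rewrite invr_gt0|rewrite mulr_gt0 ?invr_gt0].
move=> B n B0 n0; set T := B * _ => hT.
have [r [r0 nr rn]] := exists_root_upper d0 n0.
have n0R : 0 < n%:R :> R by rewrite ltr0n.
have r0R : 0 < r%:R :> R by rewrite ltr0n.
have ln0 : 0 <= ln (n%:R : R) by rewrite ln_ge0// ler1n.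
have gT : L + 8 + ln n%:R <= g * T / 2.
  have : (L + 8) * (1 + ln n%:R) <= g * T / 2.
    have -> : (L + 8) * (1 + ln n%:R) = g / 2 * (2 / g * (L + 8) * (1 + ln n%:R)).
      by field; rewrite gt_eqF.
    by rewrite [leRHS]mulrAC ler_wpM2l// ltW// divr_gt0.
  by apply: le_trans; nra.
(* The largest amplitude that [Fclass_cell_bump] allows for K = 12 r. *)
pose a : R := B / ((12 * r)%:R ^+ m * M ^+ d).
have den0 : 0 < (12 * r)%:R ^+ m * M ^+ d :> R.
  by rewrite mulr_gt0 ?exprn_gt0// ltr0n muln_gt0.
have a0 : 0 <= a by rewrite divr_ge0// ltW.
have aB : a * ((12 * r)%:R ^+ m * M ^+ d) <= B by rewrite /a divfK// gt_eqF.
have ak : g * T <= a * k.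
  rewrite /T powRN; set p := n%:R `^ _.
  have p0 : 0 < p by rewrite powR_gt0.
  have -> : g * (B / p) = (B * k) / (24 ^+ m * p * M ^+ d).
    by rewrite /g; field; rewrite !gt_eqF ?exprn_gt0.
  have -> : a * k = (B * k) / ((12 * r)%:R ^+ m * M ^+ d).
    by rewrite /a mulrAC.
  rewrite ler_pM2l ?mulr_gt0// lef_pV2 ?posrE ?mulr_gt0 ?exprn_gt0//; last first.
    by rewrite ltr0n muln_gt0.
  rewrite ler_wpM2r ?exprn_ge0 ?(ltW M0)//.
  have -> : (24 : R) = 12 * 2 by ring.
  rewrite natrM !exprMn -mulrA ler_wpM2l ?exprn_ge0//.
  exact: root_upper_powR.
(* e^u will bound the normalising constant from below. The summand 8 absorbs ln 4 in the sup-log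
   bound and forces e^(-u) <= 1/8 for the other two. *)
pose u : R := g * T / 2 + 8.
have zle : expR u <= expR (a * k) / (24 * r%:R) ^+ d.
  rewrite ler_pdivlMr ?exprn_gt0 ?mulr_gt0//.
  apply: (@le_trans _ _ (expR u * (expR L * expR (ln n%:R)))).
    rewrite ler_wpM2l ?expR_ge0// !lnK ?posrE ?exprn_gt0//.
    have -> : (48 : R) = 24 * 2 by ring.
    rewrite !exprMn -mulrA ler_wpM2l ?exprn_ge0// -!natrX -natrM ler_nat//.
  by rewrite -!expRD ler_expR /u; lra.
have eu8 : (expR u)^-1 <= 8^-1.
  rewrite lef_pV2 ?posrE ?expR_gt0//.
  have : 1 + u <= expR u by exact: expR_ge1Dx.
  by rewrite /u; nra.
have ln4 : - 8 <= ln (4^-1 : R).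
  rewrite lnV ?posrE// lerN2.
  have -> : (4 : R) = 1 + 3 by ring.
  have : ln (1 + 3 : R) <= 3 by apply: le_ln1Dx; lra.
  by lra.
have hard dO (Om : measurableType dO) (POm : probability Om R) (A : stoch_alg R d Om) :=
  hard_instance (Ordinal d0) POm (A := A) r0 nr a0 (ltW B0) hM aB.
split; apply: err_ad_stoch_ge => dO Omega POm A mA;
  have [f [b [Ff hQ /(_ _ (expR_gt0 u) zle) [hP hP']]]] := hard _ _ POm A mA;
  exists f => //.
- apply: (@le_trans _ _ (u + ln 4^-1)%:E); first by rewrite lee_fin /u; lra.
  apply: D_suplog_ge hQ => //; first exact: mA.
    exact: measurable_halfspace.
  by rewrite expRN; case/andP: hP.
- have -> : 8^-1 = 4^-1 - 8^-1 :> R by field.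
  apply: (D_TV_ge (measurable_halfspace _ b)).
    case/andP: hP => P0 P1; apply/andP; split; first exact: P0.
    by apply: (le_trans P1); rewrite lee_fin.
  rewrite hQ/=; apply: probability_le1.
  by rewrite -[X in measurable X]setTI; apply: mA => //; exact: measurable_halfspace.
- have -> : 6^-1 * 8^-1 = 6^-1 * (4^-1 - 8^-1) :> R by field.
  apply: (W1_ge (measurable_halfspace _ b) (measurable_wide_halfspace _ b) _ hQ) => //.
    by apply: (le_trans hP'); rewrite lee_fin.
  by move=> x y; exact: eucl_dist_halfspace.
Qed.
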